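(* Let $\{X_k : k \geq 1\}$ be independent random variables, each uniformly distributed in $(0,1)$, and consider the random sets of directions $$\Omega_{\text{rand},\text{lin}} := \left\{ \frac{\pi X_k}{k} : k \geq 1\right\}, \qquad \Omega_{\text{rand},\text{lac}} := \left\{ \frac{\pi X_k}{2^k} : k \geq 1\right\}.$$ Then, almost surely, for every $1 < p < \infty$ neither of the directional maximal operators $M_{\Omega_{\text{rand},\text{lin}}}$ and $M_{\Omega_{\text{rand},\text{lac}}}$ is bounded on $L^p(\mathbb{R}^2)$.
   Context: Let $\mathcal{R}$ be the collection of all (non-degenerate) rectangles in the plane $\mathbb{R}^2$, with arbitrary orientation. For $R \in \mathcal{R}$, $\omega_R \in [0,\pi)$ denotes the angle that its longest side makes with the $Oy$-axis. A set of directions $\Omega$ is identified with a set of angles; here $\Omega \subset (0,\pi)$. Set $\mathcal{R}_\Omega := \{R \in \mathcal{R} : \omega_R \in \Omega\}$. The directional maximal operator $M_\Omega$ is defined, for $f : \mathbb{R}^2 \to \mathbb{R}$ locally integrable and $x \in \mathbb{R}^2$, by $$M_\Omega f(x) := \sup_{x \in R \in \mathcal{R}_\Omega} \frac{1}{|R|}\int_R |f|,$$ where $|R|$ is the Lebesgue measure of $R$. $M_\Omega$ is bounded on $L^p(\mathbb{R}^2)$ if there is a finite constant $C$ with $\|M_\Omega f\|_p \leq C \|f\|_p$ for all $f \in L^p(\mathbb{R}^2)$. *)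

(* Defs.v *)
From HB Require Import structures.
From mathcomp Require Import all_boot all_order all_algebra finmap.
From mathcomp Require Import all_classical all_reals all_analysis.

Set Implicit Arguments.
Unset Strict Implicit.
Unset Printing Implicit Defensive.

Import Order.TTheory GRing.Theory Num.Theory.
Import numFieldNormedType.Exports.

Local Open Scope classical_set_scope.
Local Open Scope ring_scope.

(* The plane, with its Borel sigma-algebra.  L^p spaces and averages are the same
   as for Lebesgue measurable functions, since each of those agrees almost
   everywhere with a Borel function. *)
Notation plane R := (measurableTypeR R * measurableTypeR R)%type.

Definition plane_measure (R : realType) : {measure set plane R -> \bar R} :=
  (@lebesgue_measure R \x @lebesgue_measure R)%E.

(* The closed rectangle centered at c whose sides have lengths 2 * a, along the
   unit vector (- sin w, cos w), and 2 * b, along (cos w, sin w).  The first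
   vector is the image of the positive Oy half-axis under the counterclockwise
   rotation of angle w. *)
Definition rectangle (R : realType) (c : plane R) (w a b : R) : set (plane R) :=
  [set x : plane R |
    `|(x.2 - c.2 : R) * cos w - (x.1 - c.1 : R) * sin w| <= a /\
    `|(x.1 - c.1 : R) * cos w + (x.2 - c.2 : R) * sin w| <= b].

(* Q is a non-degenerate rectangle and w is the angle in [0, pi[ between a
   longest side of Q and the Oy axis.  The angle is unique unless Q is a
   square, in which case both directions of sides qualify. *)
Definition longest_side_angle (R : realType) (Q : set (plane R)) (w : R) : Prop :=
  0 <= w < pi /\
  exists (c : plane R) (a b : R), 0 < b <= a /\ Q = rectangle c w a b.

Definition rectangles_along (R : realType) (Omega : set R) :
    set (set (plane R)) :=
  [set Q | exists2 w, Omega w & longest_side_angle Q w].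

Definition directional_maximal (R : realType) (Omega : set R)
    (f : plane R -> R) (x : plane R) : \bar R :=
  ereal_sup
    [set ((fine (plane_measure R Q))^-1%:E *
          \int[plane_measure R]_(y in Q) `|f y|%:E)%E
    | Q in [set Q | rectangles_along Omega Q /\ Q x]].

Definition maximal_bounded (R : realType) (Omega : set R) (p : R) : Prop :=
  exists C : R, forall f : plane R -> R, f \in Lfun (plane_measure R) p%:E ->
    ('N[plane_measure R]_(p%:E)[directional_maximal Omega f] <=
     C%:E * 'N[plane_measure R]_(p%:E)[EFin \o f])%E.

(* Mutual independence of the subfamily of X indexed by D. *)
Definition mutually_independent (d : measure_display) (T : measurableType d)
    (R : realType) (P : probability T R) (I : choiceType) (D : set I)
    (X : I -> {RV P >-> R}) : Prop :=
  forall (J : {fset I}) (A : I -> set R),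
    [set` J] `<=` D -> (forall i, measurable (A i)) ->
    P (\bigcap_(i in [set` J]) X i @^-1` A i) =
    (\prod_(i <- J) P (X i @^-1` A i))%E.

Definition uniform01 (d : measure_display) (T : measurableType d)
    (R : realType) (P : probability T R) (X : {RV P >-> R}) : Prop :=
  forall A : set R, measurable A ->
    distribution P X A = uniform_prob (@ltr01 R) A.

Definition Omega_lin (R : realType) (x : nat -> R) : set R :=
  [set pi * x k / k%:R | k in [set k | (1 <= k)%N]].

Definition Omega_lac (R : realType) (x : nat -> R) : set R :=
  [set pi * x k / 2 ^+ k | k in [set k | (1 <= k)%N]].

(* Main.v *)
Require Import Defs.
From HB Require Import structures.
From mathcomp Require Import all_boot all_order all_algebra finmap.
From mathcomp Require Import all_classical all_reals all_analysis.
From mathcomp Require Import measurable_realfun.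
From mathcomp Require Import zify ring lra.

Set Implicit Arguments.
Unset Strict Implicit.
Unset Printing Implicit Defensive.

Import Order.TTheory GRing.Theory Num.Theory.
Import numFieldNormedType.Exports.

Local Open Scope classical_set_scope.
Local Open Scope ring_scope.

(** The sets of directions of the theorem are of the form pi * X k / lam k with
    lam k = k or lam k = 2 ^ k.  All that matters about lam is that it tends to
    infinity and that it is nondecreasing and at most doubles at each step.

    Probability.  Fix N and cut the indices into consecutive blocks of length N.
    Since lam varies by at most a factor 2 ^ N inside a block, the event that
    the directions of a block lie one by one in the intervals
    ]s * (j + 1/16), s * (j + 3/16)[ for j < N, with s the natural scale of the
    block, has a probability bounded below independently of the block.  These
    events are independent, so almost surely one of them occurs beyond any
    given index (independent_recurrence, ae_near_progressions): the random set
    contains, up to errors smaller than s / 4, arithmetic progressions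
    0, s, ..., (N - 1) * s of every length N, with s arbitrarily small.

    Geometry.  Such a set of directions is as bad as N = 2 ^ n uniformly
    distributed directions after the anisotropic dilation of ratio s along Ox,
    and those are bad by the construction of Besicovitch sets.
    Tube j is a strip of width s / 2 around the line
    x = axis j - tan (w j) * y, with w j close to s * j and
    axis j = s / n * (sum of i * 2 ^ i over the binary digits 1 of j, i being
    their positions).  Neglecting the perturbation of the angles, the abscissa
    at height y is s times the sum of 2 ^ i * (i / n - y) over the same i.
    - For y in [i / n, (i + 1) / n[ the digits of position less than i only
      contribute O(2 ^ i / n) to this sum, so tubes that share their
      higher digits lie in a common parallelogram (tube_sub_bundle), and the
      parts of the tubes over 0 <= y < 1 have a union of measure O(s 2 ^ n / n)
      (measure_compressed_tubes).
    - For y in [-2, -1[ the abscissas increase with j by steps of at least about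
      s, so the parts of the tubes there are disjoint and fill a set of measure
      s 2 ^ n / 2 (measure_spread_tubes).
    A rectangle of direction w j and bounded length contains both parts of
    tube j, so the maximal function of the indicator of the first union is at
    least 1/10 on the second one (maximal_spread_tubes).  An L^p bound would
    make the ratio of the two measures, of order n, bounded
    (near_progressions_unbounded). *)

(** * Shifts of the tubes *)

(** The sum of i * 2 ^ i over the positions i < m of the binary digits of j that
    are equal to 1, computed by dropping the last digit. *)
Fixpoint besicovitch_shift (m j : nat) : nat :=
  if m is m'.+1 then ((besicovitch_shift m' j./2 + j./2) * 2)%N else 0%N.

Lemma besicovitch_shift0 m : besicovitch_shift m 0 = 0%N.
Proof. by elim: m => //= m ->. Qed.

Lemma besicovitch_shift_mono m j j' : (j <= j')%N ->
  (besicovitch_shift m j <= besicovitch_shift m j')%N.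
Proof.
elim: m j j' => // m IHm j j' jj' /=.
by rewrite leq_mul2r leq_add ?IHm ?half_leq.
Qed.

Lemma besicovitch_shiftD m i q r : (r < 2 ^ i)%N ->
  besicovitch_shift m (2 ^ i * q + r) =
  (besicovitch_shift m (2 ^ i * q) + besicovitch_shift m r)%N.
Proof.
elim: m i r => // m IHm [|i] r ri.
  have -> : r = 0%N by lia.
  by rewrite besicovitch_shift0 !addn0.
have half_block x : (2 ^ i.+1 * q + x)./2 = (2 ^ i * q + x./2)%N.
  by rewrite expnS; lia.
have := half_block 0%N; rewrite !addn0 => half_block0.
have r2 : (r./2 < 2 ^ i)%N by move: ri; rewrite expnS; lia.
by rewrite /= half_block half_block0 (IHm _ _ r2); lia.
Qed.

(** This bound and the next one say that the sum of 2 ^ l * (y - l / n) over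
    the digits 1 of a number r < 2 ^ i lies in [0, 3 * 2 ^ i / n] when
    i / n <= y <= (i + 1) / n: at height y the low digits have almost no effect
    on the position of a tube.  The extra term i + 3 makes the induction on i
    close. *)
Lemma besicovitch_shift_le m i r : (r < 2 ^ i)%N ->
  (besicovitch_shift m r <= i * r)%N.
Proof.
elim: m i r => // m IHm [|i] r ri /=.
  have -> : r = 0%N by lia.
  by rewrite besicovitch_shift0.
have r2 : (r./2 < 2 ^ i)%N by move: ri; rewrite expnS; lia.
by have := IHm _ _ r2; have := odd_double_half r; nia.
Qed.

Lemma besicovitch_shift_ge m i r : (i <= m)%N -> (r < 2 ^ i)%N ->
  (i.+1 * r + i + 3 <= besicovitch_shift m r + 3 * 2 ^ i)%N.
Proof.
elim: m i r => [|m IHm] [|i] r im ri //=.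
- by lia.
- by rewrite expn0 in ri *; lia.
have r2 : (r./2 < 2 ^ i)%N by move: ri; rewrite expnS; lia.
have := IHm _ _ im r2; rewrite expnS; have := odd_double_half r.
by case: (odd r) => /=; nia.
Qed.

(** * Norms of indicators and of functions bounded below *)

Section norms.
Context d (T : measurableType d) (R : realType) (mu : {measure set T -> \bar R}).
Import HBNNSimple.

(** Markov's inequality: the integral of a nonnegative function is a supremum
    over the simple functions below it, and c times the indicator of A is one of
    them. *)
Lemma ge_level_le_integral (f : T -> \bar R) (A : set T) (c : R) :
  measurable A -> 0 <= c -> (forall x, 0 <= f x)%E ->
  (forall x, A x -> c%:E <= f x)%E -> (c%:E * mu A <= \int[mu]_x f x)%E.
Proof.
move=> mA c0 f0 cf.
rewrite ge0_integralTE//; apply: ereal_sup_ubound.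
exists (scale_nnsfun (indic_nnsfun R mA) c0) => /=.
  move=> x; rewrite /= /measurable_realfun.mindic indicE.
  case: (boolP (x \in A)) => [|_]; last by rewrite mulr0.
  by rewrite inE mulr1 => /cf.
by rewrite sintegralrM sintegral_indic.
Qed.

Lemma Lnorm_indic p (A : set T) : 0 < p -> measurable A ->
  ('N[mu]_(p%:E)[EFin \o (\1_A : T -> R)] = (mu A) `^ p^-1)%E.
Proof.
move=> p0 mA; rewrite unlock; congr (_ `^ _)%E.
rewrite -[in RHS](setIT A) -(integral_indic mu measurableT mA).
apply: eq_integral => x _ /=; rewrite indicE; case: (x \in A) => /=.
  by rewrite normr1 powR1.
by rewrite normr0 powR0// gt_eqF.
Qed.

Lemma Lnorm_ge_level (f : T -> \bar R) (A : set T) (c p : R) :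
  0 < p -> measurable A -> 0 <= c ->
  (forall x, A x -> c%:E <= f x)%E ->
  (c%:E * (mu A) `^ p^-1 <= 'N[mu]_(p%:E)[f])%E.
Proof.
move=> p0 mA c0 cf.
have -> : (c%:E = (c `^ p)%:E `^ p^-1)%E.
  by rewrite poweR_EFin -powRrM divff ?gt_eqF// powRr1.
rewrite -poweRM ?lee_fin ?powR_ge0//.
rewrite unlock.
apply: gt0_ler_poweR; first by rewrite invr_ge0 ltW.
- by rewrite in_itv /= leey andbT mule_ge0// lee_fin powR_ge0.
- by rewrite in_itv /= leey andbT integral_ge0// => x _; rewrite poweR_ge0.
apply: ge_level_le_integral => //.
- by rewrite powR_ge0.
- by move=> x; rewrite poweR_ge0.
move=> x /cf cfx; rewrite -poweR_EFin.
apply: gt0_ler_poweR; first exact: ltW.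
- by rewrite in_itv /= leey andbT lee_fin.
- by rewrite in_itv /= leey andbT.
- by apply: le_trans cfx _; exact: lee_abs.
Qed.
End norms.

(** * Parallelograms with two horizontal sides *)

Section parallelogram.
Context (R : realType).
Implicit Types (b c d l u : R).

Definition parallelogram b c d l u : set (plane R) :=
  [set x : plane R | c <= (x.2 : R) < d /\ l <= x.1 + b * x.2 <= u].

Lemma measurable_linear_form (a b : R) :
  measurable_fun setT (fun x : plane R => a * x.1 + b * x.2).
Proof. by apply: measurable_funD; apply: measurable_funM. Qed.

Lemma measurable_parallelogram b c d l u :
  measurable (parallelogram b c d l u).
Proof.
have -> : parallelogram b c d l u =
    (snd @^-1` `[c, d[) `&` ((fun x : plane R => 1 * x.1 + b * x.2) @^-1` `[l, u]).
  by apply/seteqP; split=> x /=; rewrite !in_itv /= mul1r.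
apply: measurableI.
- by rewrite -[X in measurable X]setTI; exact: measurable_snd.
- by rewrite -[X in measurable X]setTI; exact: measurable_linear_form.
Qed.

(** By Tonelli's theorem, as all horizontal slices are intervals of length
    u - l. *)
Lemma measure_parallelogram b c d l u : c <= d -> l <= u ->
  plane_measure R (parallelogram b c d l u) = ((d - c) * (u - l))%:E.
Proof.
move=> cd lu; set A := parallelogram _ _ _ _ _.
have mA : measurable A := measurable_parallelogram _ _ _ _ _.
rewrite /plane_measure /=.
transitivity (\int[@lebesgue_measure R]_(y in `[c, d[) (u - l)%:E)%E; last first.
  rewrite integral_cst//= lebesgue_measure_itv /= lte_fin.
  case: ltgtP cd => // [cd _|-> _]; first by rewrite -EFinB -EFinM mulrC.
  by rewrite mule0 subrr mul0r.
(* The product measure integrates the vertical slices; exchange the integrals. *)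
have := indic_fubini_tonelli (@lebesgue_measure R) (@lebesgue_measure R) mA.
rewrite (indic_fubini_tonelli_FE _ mA) (indic_fubini_tonelli_GE _ mA) /product_measure1 => ->.
rewrite [RHS]integral_mkcond; apply: eq_integral => y _ /=.
rewrite patchE; case: ifPn => [|]; rewrite ?inE ?notin_setE /= in_itv /= => ycd.
  have -> : ysection A y = `[l - b * y, u - b * y]%classic.
    apply/seteqP; split => x; rewrite /ysection /= inE /A /parallelogram /= in_itv /=.
      by move=> [_]; rewrite lerBrDr lerBlDr.
    by rewrite lerBlDr lerBrDr.
  rewrite lebesgue_measure_itv /= lte_fin ltrD2r.
  case: ltgtP lu => // [_ _|-> _]; last by rewrite subrr.
  by rewrite -EFinB; congr (_%:E); ring.
have -> : ysection A y = set0.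
  by apply/seteqP; split => x //; rewrite /ysection /= inE /A /parallelogram /= => -[].
by rewrite measure0.
Qed.
End parallelogram.

(** * A Besicovitch set adapted to perturbed directions *)

Lemma sum_pow2_rev n : (\sum_(i < n) 2 ^ (n - i) <= 2 * 2 ^ n)%N.
Proof.
suff : (\sum_(i < n) 2 ^ (n - i) + 2 <= 2 * 2 ^ n)%N by lia.
elim: n => [|n IHn]; first by rewrite big_ord0.
rewrite big_ord_recl subn0.
under eq_bigr => i _ do rewrite lift0 subSS.
by rewrite -addnA [(2 * 2 ^ n.+1)%N]mul2n -addnn leq_add // expnS.
Qed.

Lemma mem_bigsetU (T : Type) (F : nat -> set T) n x :
  (\big[setU/set0]_(i < n) F i) x <-> exists2 i, (i < n)%N & F i x.
Proof. by rewrite -bigcup_mkord. Qed.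

Section besicovitch.
Context (R : realType) (n : nat) (s : R) (w : nat -> R).
Hypotheses (n_gt0 : (0 < n)%N) (s_gt0 : 0 < s).
Hypothesis w_slope : forall j, (j < 2 ^ n)%N ->
  s * j%:R <= tan (w j) <= s * (j%:R + 1 / 4).

Let mu := plane_measure R.

Definition axis (j : nat) : R := s * ((besicovitch_shift n j)%:R / n%:R).

Definition tube (j : nat) (c d : R) : set (plane R) :=
  parallelogram (tan (w j)) c d (axis j - s / 4) (axis j + s / 4).

Definition compressed_tubes : set (plane R) :=
  \big[setU/set0]_(j < 2 ^ n) tube j 0 1.

Definition spread_tubes : set (plane R) :=
  \big[setU/set0]_(j < 2 ^ n) tube j (- 2) (- 1).

Lemma measurable_tube j c d : measurable (tube j c d).
Proof. exact: measurable_parallelogram. Qed.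

Lemma measure_tube j c : mu (tube j c (c + 1)) = (s / 2)%:E.
Proof.
by rewrite /mu measure_parallelogram; [congr (_%:E); by field | lra | have := s_gt0; lra].
Qed.

Lemma measurable_compressed_tubes : measurable compressed_tubes.
Proof. by apply: bigsetU_measurable => j _; exact: measurable_tube. Qed.

Lemma measurable_spread_tubes : measurable spread_tubes.
Proof. by apply: bigsetU_measurable => j _; exact: measurable_tube. Qed.

(** At a height y <= -1 both the shifts and the slopes push tube k to the
    right of tube j: the centers differ by at least 3 / 4 * s, more than the
    width s / 2 of the tubes. *)
Lemma tube_disjoint j k x : (j < k < 2 ^ n)%N ->
  tube j (- 2) (- 1) x -> tube k (- 2) (- 1) x -> False.
Proof.
have s0 := s_gt0.
move=> /andP[jk kn] [/andP[_ x2] /andP[_ xj]] [_ /andP[xk _]].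
have /andP[_ tj] := w_slope (ltn_trans jk kn).
have /andP[tk _] := w_slope kn.
have jk1 : j%:R + 1 <= k%:R :> R by rewrite natr1 ler_nat.
have axis_jk : axis j <= axis k.
  rewrite /axis ler_pM2l// ler_pM2r ?invr_gt0 ?ltr0n// ler_nat.
  exact: besicovitch_shift_mono (ltnW jk).
have gap : s * (3 / 4) <= tan (w k) - tan (w j).
  have : s * (j%:R + 1) <= s * k%:R by rewrite ler_pM2l.
  lra.
have : (tan (w k) - tan (w j)) * (- x.2 : R) <= s / 2 by lra.
have : s * (3 / 4) * 1 <= (tan (w k) - tan (w j)) * (- x.2 : R).
  by apply: ler_pM => //; lra.
lra.
Qed.

Lemma measure_spread_tubes : mu spread_tubes = (s * 2 ^+ n / 2)%:E.
Proof.
rewrite /spread_tubes measure_bigsetU_ord.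
- rewrite (eq_bigr (fun=> (s / 2)%:E)) => [|j _]; last first.
    by rewrite -(measure_tube j (- 2)); congr (mu (tube _ _ _)); lra.
  rewrite sumEFin sumr_const card_ord; congr (_%:E).
  by rewrite -[LHS]mulr_natr natrX; ring.
- by move=> j; exact: measurable_tube.
move=> j k _ _ [x [xj xk]]; apply/val_inj.
case: (ltngtP j k) => // jk; exfalso.
- by apply: tube_disjoint xj xk; rewrite jk ltn_ord.
- by apply: tube_disjoint xk xj; rewrite jk ltn_ord.
Qed.

(** A parallelogram containing, at heights between i / n and (i + 1) / n, all
    the tubes whose index is of the form 2 ^ i * q + r with r < 2 ^ i. *)
Definition bundle (i q : nat) : set (plane R) :=
  parallelogram (s * (2 ^ i * q)%:R) (i%:R / n%:R) (i.+1%:R / n%:R)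
    (axis (2 ^ i * q) - s * (3 * 2 ^+ i / n%:R + 1 / 2)) (axis (2 ^ i * q) + s / 2).

Lemma measure_bundle i q :
  mu (bundle i q) = (s / n%:R * (3 * 2 ^+ i / n%:R + 1))%:E.
Proof.
have s0 := s_gt0; have n0 : (0 : R) < n%:R by rewrite ltr0n.
rewrite /mu measure_parallelogram.
- by congr (_%:E); rewrite -natr1; field; rewrite gt_eqF.
- by rewrite ler_pM2r ?invr_gt0// ler_nat.
have : 0 <= s * (3 * 2 ^+ i / n%:R + 1 / 2).
  by rewrite mulr_ge0 ?addr_ge0 ?mulr_ge0 ?invr_ge0 ?exprn_ge0 ?ltW.
lra.
Qed.

(** Writing j = 2 ^ i * q + r, the axis of tube j deviates at height y from the
    line of index 2 ^ i * q by s * (besicovitch_shift n r / n - r * y), which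
    lies in [- 3 * s * 2 ^ i / n, 0].  The width of the tube and the
    perturbation of its slope account for the remaining margin s / 2. *)
Lemma tube_sub_bundle j x : (j < 2 ^ n)%N -> tube j 0 1 x ->
  exists2 i, (i < n)%N & bundle i (j %/ 2 ^ i) x.
Proof.
move=> jn [/andP[x2_ge0 x2_lt1] /andP[xl xu]].
have s0 := s_gt0; have n0 : (0 : R) < n%:R by rewrite ltr0n.
set y : R := x.2 in x2_ge0 x2_lt1 xl xu *.
set i := Num.truncn (n%:R * y).
have /andP[iy yi] : i%:R <= n%:R * y < i.+1%:R.
  by apply: truncn_itv; rewrite mulr_ge0// ltW.
have i_lt_n : (i < n)%N.
  by rewrite -(ltr_nat R) (le_lt_trans iy)// -[ltRHS]mulr1 ltr_pM2l.
exists i => //.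
set q := (j %/ 2 ^ i)%N; set r := (j %% 2 ^ i)%N.
have jqr : j = (2 ^ i * q + r)%N by rewrite mulnC; exact: divn_eq.
have r_lt : (r < 2 ^ i)%N by rewrite ltn_pmod// expn_gt0.
have /andP[tl tu] := w_slope jn.
have := besicovitch_shift_ge (ltnW i_lt_n) r_lt.
have := besicovitch_shift_le n r_lt.
have axisD : axis j = axis (2 ^ i * q) + s * ((besicovitch_shift n r)%:R / n%:R).
  by rewrite /axis {1}jqr besicovitch_shiftD// natrD; ring.
set g := besicovitch_shift n r in axisD *.
rewrite -(ler_nat R) natrM => g_le; rewrite -(ler_nat R) !natrD !natrM natrX => g_ge.
have jE : j%:R = (2 ^ i * q)%:R + r%:R :> R by rewrite {1}jqr natrD.
split; first by rewrite -/y ler_pdivrMr// ltr_pdivlMr// [y * _]mulrC iy.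
have r0 : (0 : R) <= r%:R by [].
set a := axis (2 ^ i * q) in axisD *; set b := (2 ^ i * q)%:R in jE *.
set h := g%:R / n%:R in axisD.
have h_le : h <= r%:R * y.
  rewrite /h ler_pdivrMr// (le_trans g_le)// -mulrA mulrC ler_wpM2l//.
  by rewrite mulrC.
have h_ge : r%:R * y <= h + 3 * 2 ^+ i / n%:R.
  rewrite /h -mulrDl ler_pdivlMr// -mulrA.
  have : r%:R * (y * n%:R) <= r%:R * i.+1%:R by rewrite ler_wpM2l// mulrC ltW.
  have : (0 : R) <= i%:R by [].
  lra.
have sh_le : s * h <= s * (r%:R * y) by rewrite ler_pM2l.
have sh_ge : s * (r%:R * y) <= s * (h + 3 * 2 ^+ i / n%:R) by rewrite ler_pM2l.
have ty_ge : s * j%:R * y <= tan (w j) * y by rewrite ler_wpM2r.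
have ty_le : tan (w j) * y <= s * (j%:R + 1 / 4) * y by rewrite ler_wpM2r.
have sy : s * y <= s by rewrite -[leRHS]mulr1 ler_pM2l// ltW.
rewrite jE in ty_ge ty_le; rewrite axisD in xl xu.
by apply/andP; split; lra.
Qed.

(** For each i < n there are 2 ^ (n - i) bundles, of total measure
    s / n * (3 * 2 ^ n / n + 2 ^ (n - i)); the geometric sum over i gives the
    factor 5. *)
Lemma measure_compressed_tubes :
  (mu compressed_tubes <= (5 * (s * 2 ^+ n) / n%:R)%:E)%E.
Proof.
have s0 := s_gt0; have n0 : (0 : R) < n%:R by rewrite ltr0n.
pose layer i := \big[setU/set0]_(q < 2 ^ (n - i)) bundle i q.
have mbundle i q : measurable (bundle i q).
  exact: measurable_parallelogram.
have mlayer i : measurable (layer i).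
  by apply: bigsetU_measurable => q _; exact: mbundle.
have compressed_sub : compressed_tubes `<=` \big[setU/set0]_(i < n) layer i.
  move=> x /(mem_bigsetU (fun j => tube j 0 1))[j jn xj].
  have [i i_lt_n xb] := tube_sub_bundle jn xj.
  apply/mem_bigsetU; exists i => //; apply/(mem_bigsetU (bundle i)).
  exists (j %/ 2 ^ i)%N => //.
  by rewrite ltn_divLR ?expn_gt0// -expnD subnK// ltnW.
have measure_layer i : (i < n)%N -> (mu (layer i) <=
    (s / n%:R * (3 * 2 ^+ n / n%:R + (2 ^ (n - i))%:R))%:E)%E.
  move=> i_lt_n; apply: le_trans (_ : (_ <= \sum_(q < 2 ^ (n - i)) mu (bundle i q))%E) _.
    by apply: content_subadditive.
  rewrite (eq_bigr (fun=> (s / n%:R * (3 * 2 ^+ i / n%:R + 1))%:E)) => [|q _]; last first.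
    exact: measure_bundle.
  rewrite sumEFin sumr_const card_ord lee_fin.
  have -> : 2 ^+ n = 2 ^+ i * (2 ^ (n - i))%:R :> R.
    by rewrite natrX -exprD subnKC// ltnW.
  rewrite -[leLHS]mulr_natr; set X := _%:R; set Y := 2 ^+ i.
  by rewrite le_eqVlt; apply/orP; left; apply/eqP; ring.
apply: le_trans (_ : (_ <= \sum_(i < n) mu (layer i))%E) _.
  by apply: content_subadditive => //; exact: measurable_compressed_tubes.
apply: (@le_trans _ _ (\sum_(i < n)
    (s / n%:R * (3 * 2 ^+ n / n%:R + (2 ^ (n - i))%:R))%:E)%E).
  by apply: lee_sum => i _; exact: measure_layer.
rewrite sumEFin lee_fin -mulr_sumr big_split /= sumr_const card_ord -natr_sum.
rewrite -[_ / _ *+ n]mulr_natr divfK ?gt_eqF//.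
have : (\sum_(i < n) 2 ^ (n - i))%:R <= 2 * 2 ^+ n :> R.
  by rewrite -natrX -natrM ler_nat sum_pow2_rev.
set S := _%:R => S_le.
have -> : 5 * (s * 2 ^+ n) / n%:R = s / n%:R * (5 * 2 ^+ n) by ring.
by rewrite ler_pM2l ?divr_gt0//; lra.
Qed.

Hypothesis w_acute : forall j, (j < 2 ^ n)%N -> 0 < w j < pi /\ 0 < cos (w j).
Hypothesis s_small : s * (2 ^ n)%:R <= 1 / 8.

(** The rectangle Q centered at (axis j, 0) with half-sides 3 and
    s / 4 * cos (w j) is carried by the same strip as tube j.  It contains
    the strip over -2 <= y <= 1, hence the part over 0 <= y < 1, of measure s / 2,
    and it lies over -5 <= y < 5, so that its measure is at
    most 5 * s. *)
Lemma maximal_spread_tubes (Omega : set R) x :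
  (forall j, (j < 2 ^ n)%N -> Omega (w j)) -> spread_tubes x ->
  ((1 / 10)%:E <= directional_maximal Omega (\1_compressed_tubes) x)%E.
Proof.
have s0 := s_gt0.
move=> w_Omega /(mem_bigsetU (fun j => tube j (- 2) (- 1)))[j jn xj].
have [/andP[w0 wpi] cw] := w_acute jn.
have /andP[tl tu] := w_slope jn.
have j1 : j%:R + 1 <= (2 ^ n)%:R :> R by rewrite natr1 ler_nat.
have t_ge0 : 0 <= tan (w j) by apply: le_trans tl; rewrite mulr_ge0// ltW.
have t_small : tan (w j) + s / 2 <= 1 / 8.
  have : s * (j%:R + 1) <= s * (2 ^ n)%:R by rewrite ler_pM2l.
  have := s_small; lra.
have sinE : sin (w j) = tan (w j) * cos (w j).
  by rewrite /tan divfK// gt_eqF.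
pose Q := rectangle ((axis j, 0) : plane R) (w j) 3 (s / 4 * cos (w j)).
have tube_sub_Q y : - 2 <= (y.2 : R) <= 1 ->
    axis j - s / 4 <= y.1 + tan (w j) * y.2 <= axis j + s / 4 -> Q y.
  move=> y2 y1; rewrite /Q /rectangle /= subr0.
  set Y : R := y.2 in y2 y1 *; set X : R := y.1 in y1 *; set a := axis j in y1 *.
  set t := tan (w j) in t_ge0 t_small sinE y1 *.
  have {}y1 : `|X - a + t * Y| <= s / 4 by rewrite ler_norml; lra.
  have {}y2 : `|Y| <= 2 by rewrite ler_norml; lra.
  have t_small' : t <= 1 / 8 by lra.
  split.
    have -> : Y * cos (w j) - (X - a) * sin (w j) =
      Y * cos (w j) + t * Y * sin (w j) - (X - a + t * Y) * sin (w j) by ring.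
    apply: le_trans (ler_normB _ _) _.
    apply: le_trans (lerD (ler_normD _ _) (lexx _)) _.
    have c1 := cos_max (w j); have s1 := sin_max (w j).
    have : `|Y * cos (w j)| <= 2 * 1 by rewrite normrM ler_pM.
    have : `|t * Y * sin (w j)| <= 1 / 8 * 2 * 1.
      rewrite (normrM (t * Y)) (normrM t) (ger0_norm t_ge0).
      by apply: ler_pM => //; [exact: mulr_ge0 | exact: ler_pM].
    have : `|(X - a + t * Y) * sin (w j)| <= s / 4 * 1 by rewrite normrM ler_pM.
    lra.
  have -> : (X - a) * cos (w j) + Y * sin (w j) = (X - a + t * Y) * cos (w j).
    by rewrite sinE; ring.
  by rewrite normrM (gtr0_norm cw) ler_pM2r.
have Q_sub : Q `<=` parallelogram (tan (w j)) (- 5) 5 (axis j - s / 4) (axis j + s / 4).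
  move=> y; rewrite /Q /rectangle /parallelogram /= subr0.
  set Y : R := y.2; set X : R := y.1; set a := axis j.
  set t := tan (w j) in t_ge0 t_small sinE *.
  move=> [long short]; split; last first.
    have : `|X - a + t * Y| <= s / 4.
      rewrite -(ler_pM2r cw) -[X in _ * X <= _](gtr0_norm cw) -normrM.
      by move: short; rewrite sinE; congr (`|_| <= _); ring.
    by rewrite ler_norml; lra.
  (* Rotate back: y is the combination of the two coordinates along the sides. *)
  have -> : Y = (Y * cos (w j) - (X - a) * sin (w j)) * cos (w j) +
      ((X - a) * cos (w j) + Y * sin (w j)) * sin (w j).
    rewrite -[LHS]mulr1 -(cos2Dsin2 (w j)); ring.
  have c1 := cos_max (w j); have s1 := sin_max (w j).
  have long1 : `|(Y * cos (w j) - (X - a) * sin (w j)) * cos (w j)| <= 3 * 1.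
    by rewrite normrM ler_pM.
  have short1 : `|((X - a) * cos (w j) + Y * sin (w j)) * sin (w j)| <= 1 * 1.
    rewrite normrM ler_pM//; apply: le_trans short _.
    have : s / 4 * cos (w j) <= s / 4 * 1.
      by rewrite ler_pM2l ?divr_gt0// (le_trans (ler_norm _)).
    lra.
  by move: long1 short1; rewrite !ler_norml; lra.
have mQ : measurable Q.
  have -> : Q = (fun y : plane R => - sin (w j) * y.1 + cos (w j) * y.2) @^-1`
        `[- 3 - axis j * sin (w j), 3 - axis j * sin (w j)] `&`
      (fun y : plane R => cos (w j) * y.1 + sin (w j) * y.2) @^-1`
        `[axis j * cos (w j) - s / 4 * cos (w j), axis j * cos (w j) + s / 4 * cos (w j)].
    by apply/seteqP; split => y; rewrite /Q /rectangle /= !in_itv /= !ler_norml subr0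
      => -[/andP[? ?] /andP[? ?]]; split; apply/andP; split; lra.
  by apply: measurableI; rewrite -[X in measurable X]setTI;
    exact: measurable_linear_form.
have mu_Q_le : (mu Q <= (5 * s)%:E)%E.
  apply: le_trans (le_measure mu _ _ Q_sub) _; rewrite ?inE//.
    exact: measurable_parallelogram.
  rewrite [leLHS]measure_parallelogram; [|lra|lra].
  by rewrite lee_fin; lra.
have tube_QE : tube j 0 1 `<=` compressed_tubes `&` Q.
  move=> y yj; split.
    by apply/(mem_bigsetU (fun j => tube j 0 1)); exists j.
  by case: yj => /andP[y0 y1] yj; apply: tube_sub_Q => //; apply/andP; split; lra.
have mu_QE_ge : ((s / 2)%:E <= mu (compressed_tubes `&` Q))%E.
  rewrite -(measure_tube j 0) add0r; apply: le_measure; rewrite ?inE//.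
    exact: measurable_tube.
  by apply: measurableI => //; exact: measurable_compressed_tubes.
have mu_Q_ge : ((s / 2)%:E <= mu Q)%E.
  apply: le_trans mu_QE_ge (le_measure _ _ _ _); rewrite ?inE//.
  by apply: measurableI => //; exact: measurable_compressed_tubes.
apply: (@le_trans _ _ ((fine (mu Q))^-1%:E *
  \int[mu]_(y in Q) `|\1_compressed_tubes y|%:E)%E); last first.
  apply: ereal_sup_ubound; exists Q => //; split; last first.
    by case: xj => /andP[y0 y1] xj; apply: tube_sub_Q => //; apply/andP; split; lra.
  exists (w j); first exact: w_Omega.
  split; first by rewrite ltW.
  exists (axis j, 0), 3, (s / 4 * cos (w j)); split => //.
  apply/andP; split; first by rewrite mulr_gt0// divr_gt0.
  have : s / 4 * cos (w j) <= s / 4 * 1.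
    by rewrite ler_pM2l ?divr_gt0// (le_trans (ler_norm _))// cos_max.
  lra.
have -> : (\int[mu]_(y in Q) `|\1_compressed_tubes y|%:E)%E = mu (compressed_tubes `&` Q).
  rewrite -(integral_indic mu mQ measurable_compressed_tubes).
  by apply: eq_integral => y _; rewrite ger0_norm.
have : mu Q \is a fin_num.
  by rewrite ge0_fin_numE// (le_lt_trans mu_Q_le)// ltry.
move: mu_Q_le mu_Q_ge; case: (mu Q) => // m; rewrite !lee_fin /= => m_le m_ge _.
apply: le_trans (lee_wpmul2l _ mu_QE_ge); last by rewrite lee_fin invr_ge0; lra.
rewrite -EFinM lee_fin [m^-1 * _]mulrC ler_pdivlMr; lra.
Qed.
End besicovitch.

(** * Unboundedness for sets containing near-progressions *)

(** The tangent is differentiable at 0 with derivative 1; an interval of length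
    at most 1 also keeps the cosine positive. *)
Lemma tan_linear (R : realType) (e : R) : 0 < e ->
  exists2 w0 : R, 0 < w0 <= 1 & forall w, 0 < w < w0 ->
    0 < cos w /\ `|tan w - w| <= e * w.
Proof.
move=> e0.
have cos0N : cos (0 : R) != 0 by rewrite cos0 oner_eq0.
have [dtan tan'] := is_derive_tan cos0N.
have /cvgrPdist_le/(_ e e0) : (fun h : R => h^-1 *: (tan (h *: 1 + 0) - tan 0)) @ 0^' --> (1 : R).
  have : cvg ((fun h : R => h^-1 *: (tan (h *: 1 + 0) - tan 0)) @ 0^').
    by have := dtan; rewrite /derivable /=.
  move=> /cvg_ex[/= l hl]; move: tan'; rewrite cos0 expr1n invr1 /derive => tan1.
  have l1 : l = 1 := etrans (esym (cvg_lim (@norm_hausdorff _ _) hl)) tan1.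
  by move: hl; rewrite l1.
move=> /nbhs_ballP[/= r r0 rtan].
exists (Num.min r 1) => [|w /andP[w0]].
  by rewrite lt_min r0 ltr01/= ge_min lexx orbT.
rewrite lt_min => /andP[wr w1]; split.
  apply: cos_gt0_pihalf; have := pi_ge2 R; lra.
have := rtan w; rewrite /ball /= sub0r normrN gtr0_norm// => /(_ wr).
rewrite gt_eqF// => /(_ isT).
rewrite tan0 subr0 addr0 /GRing.scale /= mulr1 => tan_w.
have -> : tan w - w = - ((1 - w^-1 * tan w) * w).
  by field; rewrite gt_eqF.
by rewrite normrN normrM (gtr0_norm w0) ler_pM2r.
Qed.

(** Up to an error of a fixed proportion of s, each point s * j with j < N is in
    Omega, for every N and for arbitrarily small s.  The intervals
    stay away from s * j and s * (j + 1 / 4) so that taking tangents does not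
    leave ]s * j, s * (j + 1 / 4)[. *)
Definition contains_near_progressions (R : realType) (Omega : set R) : Prop :=
  forall (N : nat) (e : R), 0 < e ->
  exists2 s, 0 < s < e & forall j, (j < N)%N ->
    exists2 w, Omega w & s * (j%:R + 1 / 16) < w < s * (j%:R + 3 / 16).

Lemma near_progression_slopes (R : realType) (Omega : set R) (N : nat) :
  (0 < N)%N -> contains_near_progressions Omega ->
  exists s (w : nat -> R), [/\ 0 < s, s * N%:R <= 1 / 8 &
    forall j, (j < N)%N -> [/\ Omega (w j), 0 < w j < pi, 0 < cos (w j) &
      s * j%:R <= tan (w j) <= s * (j%:R + 1 / 4)]].
Proof.
move=> N_gt0 progressions; have N0 : (0 : R) < N%:R by rewrite ltr0n.
have [|w0 /andP[w0_gt0 w0_le1] tan_w0] := @tan_linear R (1 / 16 / N%:R).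
  by rewrite divr_gt0.
have [|s /andP[s0 s_lt] sP] := progressions N (Num.min (w0 / N%:R) (1 / 8 / N%:R)).
  by rewrite lt_min !divr_gt0.
move: s_lt; rewrite lt_min !ltr_pdivlMr// => /andP[sN_lt sN_lt8].
have /choice[w wP] : forall j, exists w, (j < N)%N ->
    Omega w /\ s * (j%:R + 1 / 16) < w < s * (j%:R + 3 / 16).
  move=> j; case: (ltnP j N) => [/sP[w Ow w_itv]|_]; first by exists w.
  by exists 0.
exists s, w; split => // [|j jN]; first by lra.
have [Ow /andP[w_gt w_lt]] := wP _ jN.
have sj0 : 0 <= s * j%:R by rewrite mulr_ge0// ltW.
have sjN : s * (j%:R + 1) <= s * N%:R by rewrite ler_pM2l// natr1 ler_nat.
have wj0 : 0 < w j by lra.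
have wj_lt : w j < w0 by lra.
have [|cos_w tan_w] := tan_w0 (w j); first by rewrite wj0.
have : 1 / 16 / N%:R * w j <= s / 16.
  by rewrite mulrAC ler_pdivrMr//; lra.
have := pi_ge2 R; move: tan_w; rewrite ler_norml => tan_w pi2 err.
by split => //; [apply/andP; split|]; lra.
Qed.

(** If the operator had norm at most C on L^p, the sets E and F, on which the
    indicator is 1 and the maximal function is at least 1 / 10, would satisfy
    |F| <= (10 * |C|) ^ p * |E|, contradicting |F| >= n / 10 * |E| for n
    large. *)
Proposition near_progressions_unbounded (R : realType) (Omega : set R) (p : R) :
  contains_near_progressions Omega -> 1 < p -> ~ maximal_bounded Omega p.
Proof.
move=> progressions p1 [C CP]; have p0 : 0 < p by lra.
pose K := (10 * `|C|) `^ p.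
have K0 : 0 <= K := powR_ge0 _ _.
have [n n_gt0 n_gtK] : exists2 n, (0 < n)%N & 10 * K < n%:R.
  by exists (Num.truncn (10 * K)).+1; last exact: truncnS_gt.
have nR0 : (0 : R) < n%:R by rewrite ltr0n.
have [|s [w [s0 s_small wP]]] := @near_progression_slopes _ Omega (2 ^ n) _ progressions.
  by rewrite expn_gt0.
have w_slope j : (j < 2 ^ n)%N -> s * j%:R <= tan (w j) <= s * (j%:R + 1 / 4).
  by move=> /wP[].
have w_acute j : (j < 2 ^ n)%N -> 0 < w j < pi /\ 0 < cos (w j).
  by move=> /wP[].
have w_Omega j : (j < 2 ^ n)%N -> Omega (w j) by move=> /wP[].
set E := compressed_tubes n s w; set F := spread_tubes n s w.
have mE : measurable E := measurable_compressed_tubes _ _ _.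
have mF : measurable F := measurable_spread_tubes _ _ _.
have := measure_compressed_tubes n_gt0 s0 w_slope.
have muF := measure_spread_tubes n_gt0 s0 w_slope.
have : (0 <= plane_measure R E)%E by [].
have normE := Lnorm_indic (plane_measure R) p0 mE.
case muE : (plane_measure R E) normE => [a||]// normE.
rewrite !lee_fin => a0 a_le.
have LE : (\1_E : plane R -> R) \in Lfun (plane_measure R) p%:E.
  rewrite inE; apply/andP; split; rewrite inE /=.
    exact: measurable_indic.
  by rewrite /finite_norm normE ltry.
have c0 : 0 <= 1 / 10 :> R by lra.
have M_ge x : F x -> ((1 / 10)%:E <= directional_maximal Omega (\1_E : plane R -> R) x)%E.
  exact: maximal_spread_tubes.
have := le_trans (Lnorm_ge_level (plane_measure R) p0 mF c0 M_ge) (CP _ LE).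
rewrite normE muF !poweR_EFin -!EFinM lee_fin.
set b := s * _ / 2.
have b0 : 0 < b by rewrite divr_gt0// mulr_gt0// exprn_gt0.
move=> norm_le.
have {}norm_le : b `^ p^-1 <= 10 * `|C| * a `^ p^-1.
  have : C * a `^ p^-1 <= `|C| * a `^ p^-1.
    by rewrite ler_wpM2r ?powR_ge0// ler_norm.
  lra.
have b_le : b <= K * a.
  have -> : b = (b `^ p^-1) `^ p by rewrite -powRrM mulVf ?gt_eqF// powRr1// ltW.
  have -> : K * a = (10 * `|C| * a `^ p^-1) `^ p.
    by rewrite powRM ?mulr_ge0 ?powR_ge0// -powRrM mulVf ?gt_eqF// powRr1.
  by apply: ge0_ler_powR => //; rewrite ?nnegrE ?mulr_ge0 ?powR_ge0 ?(ltW p0).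
have : b <= K * (5 * (s * 2 ^+ n) / n%:R).
  by apply: le_trans b_le _; rewrite ler_wpM2l.
have -> : K * (5 * (s * 2 ^+ n) / n%:R) = (10 * K) * b / n%:R.
  by rewrite /b; field; rewrite gt_eqF.
rewrite ler_pdivlMr// mulrC ler_pM2r//.
by move=> /(lt_le_trans n_gtK); rewrite ltxx.
Qed.

(** * Recurrence of independent events *)

Section recurrence.
Context d (T : measurableType d) (R : realType) (P : probability T R).

(** Independence is known for the events only; it passes to the complements one
    event at a time, by P (G minus A L) = P G - P (G intersected with A L). *)
Lemma measure_inter_compl (A : nat -> set T) (a : nat -> R) :
  (forall l, measurable (A l)) ->
  (forall J : {fset nat},
    P (\bigcap_(l in [set` J]) A l) = (\prod_(l <- J) a l)%:E) ->
  forall L (J : {fset nat}), (forall l, l \in J -> (L <= l)%N) ->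
    P (\bigcap_(l in [set` J]) A l `&` \bigcap_(l < L) ~` A l) =
    ((\prod_(l <- J) a l) * \prod_(l < L) (1 - a l))%:E.
Proof.
move=> mA indep; elim=> [|L IHL] J LJ.
  by rewrite big_ord0 mulr1 bigcap_mkord big_ord0 setIT.
have LnJ : L \notin J by apply/negP => /LJ; rewrite ltnn.
pose G := \bigcap_(l in [set` J]) A l `&` \bigcap_(l < L) ~` A l.
have mG : measurable G.
  by apply: measurableI; apply: fin_bigcap_measurable => // l _; exact: measurableC.
have -> : \bigcap_(l in [set` J]) A l `&` \bigcap_(l < L.+1) ~` A l = G `\` A L.
  apply/seteqP; split => [t [tJ tL]|t [[tJ tL] nAL]].
    by do !split => //; [move=> l /= lL; apply: tL; exact: ltnW | exact: (tL L (ltnSn L))].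
  by split => // l /=; rewrite ltnS leq_eqVlt => /predU1P[-> //|]; exact: tL.
have GL : G `&` A L =
    \bigcap_(l in [set` (L |` J)%fset]) A l `&` \bigcap_(l < L) ~` A l.
  rewrite /G setIAC; congr (_ `&` _).
  apply/seteqP; split => [t [tJ tL] l /=|t tLJ].
    by rewrite !inE => /orP[/eqP ->//|lJ]; exact: tJ.
  by split => [l lJ|]; apply: tLJ; rewrite /= !inE ?eqxx// [l \in J]lJ orbT.
rewrite measureD//; last by rewrite ltey_eq fin_num_measure.
rewrite GL [X in (X - _)%E]IHL => [|l /LJ/ltnW//].
rewrite [X in (_ - X)%E]IHL => [|l]; last by rewrite !inE => /orP[/eqP ->//|/LJ/ltnW].
by rewrite big_fsetU1//= big_ord_recr /= -EFinB; congr (_%:E); ring.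
Qed.

(** The probability that none of the first L events occurs is at most
    (1 - q) ^ L. *)
Lemma independent_recurrence (A : nat -> set T) (a : nat -> R) (q : R) :
  (forall l, measurable (A l)) ->
  (forall J : {fset nat},
    P (\bigcap_(l in [set` J]) A l) = (\prod_(l <- J) a l)%:E) ->
  0 < q -> (forall l, q <= a l) ->
  {ae P, forall t, exists l, A l t}.
Proof.
move=> mA indep q0 qa.
have PA l : P (A l) = (a l)%:E.
  have := indep [fset l]%fset; rewrite big_seq_fset1 => <-; congr (P _).
  apply/seteqP; split => [t tA k /=|t]; first by rewrite inE => /eqP ->.
  by apply; rewrite /= inE.
have a1 l : a l <= 1 by rewrite -lee_fin -PA; exact: probability_le1.
exists (\bigcap_l ~` A l); split.
- by apply: bigcapT_measurable => l; exact: measurableC.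
- apply/eqP; rewrite -measure_le0.
  have P_le L : (P (\bigcap_l ~` A l) <= ((1 - q) ^+ L)%:E)%E.
    have := measure_inter_compl mA indep (L := L) (J := fset0) (fun l => ltac:(by [])).
    rewrite big_seq_fset0 mul1r => PL.
    apply: (@le_trans _ _ (\prod_(l < L) (1 - a l))%:E).
      rewrite -PL; apply: le_measure; rewrite ?inE.
      + by apply: bigcapT_measurable => l; exact: measurableC.
      + by apply: measurableI; apply: fin_bigcap_measurable => // l _; exact: measurableC.
      + by move=> t tA; split => // l _; exact: tA.
    rewrite lee_fin -[in leRHS](card_ord L) -prodr_const.
    by apply: ler_prod => l _; rewrite subr_ge0 a1 lerD2l lerN2 qa.
  have : (fun L : nat => ((1 - q) ^+ L)%:E) @ \oo --> (0 : R)%:E.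
    apply: cvg_EFin; first exact: nearW.
    apply: cvg_expr; rewrite ltr_norml; have := a1 0%N; have := qa 0%N; lra.
  by move=> /cvge_to_ge; apply; exact: nearW.
by move=> t /= /forallNP tA l _ /=; exact: tA.
Qed.
End recurrence.

(** * Near-progressions among random directions *)

Lemma uniform_prob_itv (R : realType) (a b : R) : 0 <= a -> a <= b -> b <= 1 ->
  uniform_prob (@ltr01 R) `]a, b[ = (b - a)%:E.
Proof.
move=> a0 ab b1; rewrite /uniform_prob integral_uniform_pdf.
have -> : `]a, b[ `&` `[0, 1] = `]a, b[%classic :> set R.
  apply/seteqP; split => x /=; rewrite !in_itv /=; first by case.
  by move=> /andP[ax xb]; split; apply/andP; split; lra.
transitivity (\int[@lebesgue_measure R]_(x in `]a, b[) 1%:E)%E.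
  apply: eq_integral => x; rewrite inE /= in_itv /= /uniform_pdf => /andP[ax xb].
  by rewrite subr0 invr1 ifT//; lra.
rewrite integral_cst//= mul1e; move: ab.
rewrite lebesgue_measure_itv /= lte_fin le_eqVlt => /predU1P[->|->].
  by rewrite ltxx subrr.
by rewrite -EFinB.
Qed.

Section random_directions.
Context d (T : measurableType d) (R : realType) (P : probability T R).
Context (X : nat -> {RV P >-> R}) (lam : nat -> R).
Hypothesis X_independent : mutually_independent [set k | (1 <= k)%N] X.
Hypothesis X_uniform : forall k : nat, (1 <= k)%N -> uniform01 (X k).
Hypothesis lam_gt0 : forall k, (1 <= k)%N -> 0 < lam k.
Hypothesis lam_growth : forall k, (1 <= k)%N -> lam k <= lam k.+1 <= 2 * lam k.

Lemma lam_growth_iter k i : (1 <= k)%N -> lam k <= lam (k + i) <= 2 ^+ i * lam k.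
Proof.
move=> k1; elim: i => [|i /andP[IH1 IH2]]; first by rewrite addn0 expr0 mul1r lexx.
have /andP[g1 g2] := @lam_growth (k + i)%N (leq_trans k1 (leq_addr _ _)).
rewrite addnS (le_trans IH1 g1) /= (le_trans g2)// exprS -mulrA.
by rewrite ler_pM2l.
Qed.

Section blocks.
Context (N c : nat).
Hypotheses (N_gt0 : (0 < N)%N) (c_gt0 : (0 < c)%N).

(** Up to the factor pi, the common difference of the progression approximated
    by the directions of index in [b * N, (b + 1) * N[. *)
Let scale (b : nat) : R := (N%:R * lam (b.+1 * N))^-1.

(** The values of X k that put pi * X k / lam k at the place prescribed in its
    block. *)
Let target (k : nat) : set R :=
  `]lam k * scale (k %/ N) * ((k %% N)%:R + 1 / 16),
    lam k * scale (k %/ N) * ((k %% N)%:R + 3 / 16)[.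

Let hit (k : nat) : set T := X k @^-1` target k.

Let prob (k : nat) : R := lam k * scale (k %/ N) / 8.

Let block (b : nat) : seq nat := [seq b * N + j | j <- iota 0 N]%N.

(** The blocks start at index c * N, which makes their scale as small as desired
    and avoids the index 0. *)
Let good (l : nat) : set T := \bigcap_(k in [set` block (l + c)]) hit k.

Lemma block_div b k : k \in block b -> (k %/ N = b)%N.
Proof.
move=> /mapP[j]; rewrite mem_iota add0n => /andP[_ jN] ->.
by rewrite divnMDl// divn_small// addn0.
Qed.

(** The scale uses the first index of the next block, where lam is at
    least lam k, so that target k is included in [0, 1], and at most
    2 ^ N * lam k, so that its length is bounded below. *)
Lemma prob_bounds k : (N <= k)%N -> 1 / 8 / (N%:R * 2 ^+ N) <= prob k /\
  lam k * scale (k %/ N) * N%:R <= 1.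
Proof.
move=> Nk; have k1 : (1 <= k)%N by apply: leq_trans Nk.
have N0 : (0 : R) < N%:R by rewrite ltr0n.
have N2 : (0 : R) < 2 ^+ N by rewrite exprn_gt0.
have := ltn_ceil k N_gt0; set e := ((k %/ N).+1 * N)%N => k_lt.
have e_le : (e <= k + N)%N by rewrite /e mulSn addnC leq_add2r leq_trunc_div.
have l0 := lam_gt0 k1.
have /andP[le1 _] := lam_growth_iter (e - k) k1.
rewrite subnKC ?(ltnW k_lt)// in le1.
have /andP[_ le3] := lam_growth_iter N k1.
have e0 : 0 < lam e by apply: lt_le_trans le1.
have le4 : lam e <= lam (k + N).
  have /andP[] := lam_growth_iter (k + N - e) (leq_trans k1 (ltnW k_lt)).
  by rewrite subnKC.
rewrite /prob /scale -/e; split; last first.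
  have -> : lam k * (N%:R * lam e)^-1 * N%:R = lam k / lam e.
    by field; rewrite !gt_eqF.
  by rewrite ler_pdivrMr// mul1r.
have -> : lam k * (N%:R * lam e)^-1 / 8 = lam k / lam e * (1 / 8 / N%:R).
  by field; rewrite !gt_eqF.
have -> : 1 / 8 / (N%:R * 2 ^+ N) = (2 ^+ N)^-1 * (1 / 8 / N%:R) :> R.
  by field; rewrite !gt_eqF.
rewrite ler_pM2r ?divr_gt0// ler_pdivlMr// mulrC ler_pdivrMr// mulrC.
exact: le_trans le4 le3.
Qed.

Lemma measurable_hit k : measurable (hit k).
Proof. by rewrite -[hit k]setTI; apply: measurable_funP => //; exact: measurable_itv. Qed.

Lemma measure_hit k : (N <= k)%N -> P (hit k) = (prob k)%:E.
Proof.
move=> Nk; have k1 : (1 <= k)%N by apply: leq_trans Nk.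
have [prob_ge prob_le] := prob_bounds Nk.
have N0 : (0 : R) < N%:R by rewrite ltr0n.
have prob0 : 0 < prob k.
  by apply: lt_le_trans prob_ge; rewrite divr_gt0// mulr_gt0// exprn_gt0.
have mod_le : (k %% N)%:R + 1 <= N%:R :> R by rewrite natr1 ler_nat ltn_mod.
have -> : P (hit k) = distribution P (X k) (target k) by [].
rewrite X_uniform//; last exact: measurable_itv.
have pE : lam k * scale (k %/ N) = 8 * prob k by rewrite /prob; field.
rewrite /target pE uniform_prob_itv.
- by congr (_%:E); field.
- by apply: mulr_ge0; [lra | exact: addr_ge0].
- by apply: ler_wpM2l; lra.
- by rewrite pE in prob_le; apply: le_trans prob_le; apply: ler_wpM2l; lra.
Qed.

Lemma good_independent (J : {fset nat}) :
  P (\bigcap_(l in [set` J]) good l) =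
  (\prod_(l <- J) \prod_(k <- block (l + c)) prob k)%:E.
Proof.
pose s := [seq k | l <- J, k <- block (l + c)].
have uniq_s : uniq s.
  apply: allpairs_uniq_dep => [|l _|]; first exact: fset_uniq.
    by rewrite map_inj_uniq ?iota_uniq// => j k /addnI.
  move=> p1 p2 /allpairsPdep[x [y [_ xy ->]]] /allpairsPdep[x' [y' [_ xy' ->]]].
  move=> /= yy'; rewrite -yy' in xy' *.
  by have -> : x = x' by apply: (@addIn c); rewrite -(block_div xy) (block_div xy').
have N_le k : k \in s -> (N <= k)%N.
  move=> /allpairsPdep[l [k' [_ /block_div kl ->]]].
  by rewrite -divn_gt0// kl addn_gt0 c_gt0 orbT.
have -> : \bigcap_(l in [set` J]) good l = \bigcap_(k in [set` [fset k in s]%fset]) hit k.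
  apply/seteqP; split => t /= tJ.
    move=> k /=; rewrite inE /= => /allpairsPdep[l [k' [lJ k'l ->]]].
    exact: (tJ l lJ k' k'l).
  move=> l /= lJ k /= kl; apply: tJ; rewrite /= inE /=.
  by apply/allpairsPdep; exists l, k.
rewrite X_independent; last 2 first.
- by move=> k /=; rewrite inE /= => /N_le; apply: leq_trans.
- by move=> k; exact: measurable_itv.
have fsetE : perm_eq [fset k in s]%fset s.
  by apply: uniq_perm => // k; rewrite inE.
rewrite (perm_big _ fsetE) /=.
rewrite (eq_big_seq (fun k => (prob k)%:E)) => [|k /N_le/measure_hit//].
by rewrite prodEFin big_allpairs_dep.
Qed.

Lemma ae_good : {ae P, forall t, exists l, good l t}.
Proof.
pose q : R := (1 / 8 / (N%:R * 2 ^+ N)) ^+ N.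
apply: (independent_recurrence (q := q) _ good_independent).
- by move=> l; apply: fin_bigcap_measurable => // k _; exact: measurable_hit.
- by rewrite exprn_gt0// divr_gt0// mulr_gt0 ?exprn_gt0// ltr0n.
move=> l.
have -> : q = \prod_(k <- block (l + c)) (1 / 8 / (N%:R * 2 ^+ N)).
  by rewrite big_const_seq count_predT size_map size_iota iter_mulr_1.
rewrite big_seq [leRHS]big_seq; apply: ler_prod => k /block_div kl.
have [|q_le _] := @prob_bounds k; last first.
  by rewrite q_le andbT divr_ge0// mulr_ge0// exprn_ge0.
by rewrite -divn_gt0// kl addn_gt0 c_gt0 orbT.
Qed.

Lemma good_progression l t : good l t ->
  forall j k, (j < N)%N -> k = ((l + c) * N + j)%N ->
  pi * scale (l + c) * (j%:R + 1 / 16) < pi * X k t / lam k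
    < pi * scale (l + c) * (j%:R + 3 / 16).
Proof.
move=> lt j k jN kE; set s := pi * scale _.
have kb : k \in block (l + c) by rewrite kE map_f// mem_iota.
have kdiv := block_div kb.
have kmod : (k %% N = j)%N by rewrite kE modnMDl modn_small.
have k1 : (1 <= k)%N.
  by apply: leq_trans N_gt0 _; rewrite -divn_gt0// kdiv addn_gt0 c_gt0 orbT.
have := lt k kb; rewrite /hit /target /= in_itv /= kdiv kmod.
have l0 := lam_gt0 k1; have pi0 := pi_gt0 R.
move=> /andP[Xl Xu]; rewrite ltr_pdivlMr// ltr_pdivrMr//.
have sE x : s * x * lam k = pi * (lam k * scale (l + c) * x) by rewrite /s; ring.
by rewrite !sE !ltr_pM2l// Xl Xu.
Qed.
End blocks.

Hypothesis lam_unbounded : forall M, exists K, forall k, (K <= k)%N -> M < lam k.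

Lemma ae_near_progressions : {ae P, forall t,
  contains_near_progressions
    [set pi * X k t / lam k | k in [set k | (1 <= k)%N]]}.
Proof.
pose progression_at N b t := forall j k, (j < N)%N -> k = (b * N + j)%N ->
  pi * (N%:R * lam (b.+1 * N))^-1 * (j%:R + 1 / 16) < pi * X k t / lam k
    < pi * (N%:R * lam (b.+1 * N))^-1 * (j%:R + 3 / 16).
have good_ae N c : {ae P, forall t, exists l, progression_at N.+1 (l + c.+1) t}.
  have := @ae_good N.+1 c.+1 (ltn0Sn _) (ltn0Sn _).
  apply: filterS => t [l lt]; exists l; exact: good_progression lt.
have : {ae P, forall t, forall N c, exists l, progression_at N.+1 (l + c.+1) t}.
  by apply/ae_foralln => N; apply/ae_foralln => c; exact: good_ae.
apply: filterS => t prog [|N] e e0.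
  by exists (e / 2) => //; apply/andP; split; lra.
have [K lamK] := lam_unbounded (pi / e).
have [l lP] := prog N K; set b := (l + K.+1)%N in lP.
set m := (b.+1 * N.+1)%N.
have m_gt : pi / e < lam m.
  by apply: lamK; rewrite /m /b; nia.
have pi0 := pi_gt0 R.
have m0 : 0 < lam m by apply: lt_trans m_gt; rewrite divr_gt0.
exists (pi * (N.+1%:R * lam m)^-1).
  rewrite divr_gt0 ?mulr_gt0//= ltr_pdivrMr ?mulr_gt0//.
  rewrite ltr_pdivrMr// mulrC in m_gt; apply: lt_le_trans m_gt _.
  by rewrite ler_pM2l// ler_peMl ?ler1n// ltW.
move=> j jN; pose k := (b * N.+1 + j)%N.
exists (pi * X k t / lam k); last exact: lP.
by exists k => //=; rewrite /k /b; nia.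
Qed.
End random_directions.

(** * Unboundedness along random directions *)

Theorem mainTheorem1 (R : realType) (d : measure_display)
    (T : measurableType d) (P : probability T R) (X : nat -> {RV P >-> R})
    (X_independent : mutually_independent [set k | (1 <= k)%N] X)
    (X_uniform : forall k : nat, (1 <= k)%N -> uniform01 (X k)) :
  {ae P, forall t : T, forall p : R, 1 < p ->
    ~ maximal_bounded (Omega_lin (fun k => X k t)) p /\
    ~ maximal_bounded (Omega_lac (fun k => X k t)) p}.
Proof.
have lin : {ae P, forall t, contains_near_progressions (Omega_lin (fun k => X k t))}.
  apply: (ae_near_progressions X_independent X_uniform) => [k k1|k k1|M].
  - by rewrite ltr0n.
  - by rewrite -natrM !ler_nat; lia.
  - exists (Num.truncn M).+1 => k /(leq_trans _) Mk.
    by apply: lt_le_trans (truncnS_gt M) _; rewrite ler_nat; apply: Mk.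
have lac : {ae P, forall t, contains_near_progressions (Omega_lac (fun k => X k t))}.
  apply: (ae_near_progressions X_independent X_uniform) => [k k1|k k1|M].
  - by rewrite exprn_gt0.
  - by rewrite exprS lexx andbT ler_peMl ?exprn_ge0// ler1n.
  - exists (Num.truncn M).+1 => k Mk; apply: lt_le_trans (truncnS_gt M) _.
    by rewrite -natrX ler_nat (leq_trans Mk)// ltnW// ltn_expl.
apply: filterS2 lin lac => t lint lact p p1.
by split; exact: near_progressions_unbounded.
Qed.
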